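(* Let $B$ and $C$ be commutative rings such that $B$ is a free right $C$-module of rank $n$, let $r\ge 1$, and let $L_2 : B \to \mathrm{M}(n,C)$ and $L_3 : \mathrm{M}(r,B)\to \mathrm{M}(n,\mathrm{M}(r,C))$ be left regular representations. Let $\iota:\mathrm{M}(n,\mathrm{M}(r,C))\hookrightarrow \mathrm{M}(nr,C)$ be the inclusion (regarding a block matrix as an $nr\times nr$ matrix). Then $$\det{}_{nr}\circ \iota\circ L_3 \;=\; \det{}_{n}\circ L_2\circ \det{}_{r}$$ as maps $\mathrm{M}(r,B)\to C$, where $\det_r:\mathrm{M}(r,B)\to B$, $\det_n:\mathrm{M}(n,C)\to C$ and $\det_{nr}:\mathrm{M}(nr,C)\to C$ are the usual determinants.
   Context: Rings have a multiplicative unit; $\mathrm{M}(k,R)$ is the ring of $k\times k$ matrices over $R$. When a ring $A$ is said to be a free right $B$-module of rank $m$ for a ring $B$, it is understood that $B$ is a subring of $A$ and that there is an ordered basis $e=(e_1,\dots,e_m)$ with $A=\bigoplus_{i=1}^m e_iB$. For $a\in A$ there is a unique matrix $L_e(a)=(b_{ij})\in \mathrm{M}(m,B)$ with $ae_j=\sum_{i=1}^m e_ib_{ij}$ for all $j$, i.e. $ae=eL_e(a)$. The injective ring homomorphism $L_e:A\to \mathrm{M}(m,B)$ is called the left regular representation from $A$ to $\mathrm{M}(m,B)$ with respect to $e$. If $f=(f_1,\dots,f_n)$ is a basis of $B$ as a right $C$-module, then $\mathrm{M}(r,B)=\bigoplus_{i=1}^n (f_iI_r)\,\mathrm{M}(r,C)$,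 so $\mathrm{M}(r,B)$ is a free right $\mathrm{M}(r,C)$-module of rank $n$, and $L_3$ is the left regular representation with respect to an ordered basis with $n$ elements of this module (for example $(f_1I_r,\dots,f_nI_r)$). *)

(* Defs.v *)
From HB Require Import structures.
From mathcomp Require Import all_boot all_order all_algebra.

Set Implicit Arguments.
Unset Strict Implicit.
Unset Printing Implicit Defensive.

Import GRing.Theory.

Local Open Scope ring_scope.

(* A subring B of A is given by an injective ring morphism j : B -> A.       *)
(* Rings are not assumed commutative or nontrivial (pzRingType).             *)
Definition right_basis (B A : pzRingType) (j : {rmorphism B -> A}) (m : nat)
    (e : 'I_m -> A) : Prop :=
  injective j /\
  forall a : A, exists! b : 'cV[B]_m, a = \sum_(i < m) e i * j (b i 0).

Section LeftRegular.

Variables (B A : pzRingType) (j : {rmorphism B -> A}) (m : nat).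
Variable e : 'I_m -> A.
Hypothesis basis_e : right_basis j e.

Lemma right_coord_exists (a : A) :
  exists b : 'cV[B]_m, a == \sum_(i < m) e i * j (b i 0).
Proof. by have [b [/eqP def_a _]] := basis_e.2 a; exists b. Qed.

Definition right_coord (a : A) : 'cV[B]_m := xchoose (right_coord_exists a).

Definition left_regular (a : A) : 'M[B]_m :=
  \matrix_(i, k) right_coord (a * e k) i 0.

Lemma right_coordK (a : A) : a = \sum_(i < m) e i * j (right_coord a i 0).
Proof. exact/eqP/(xchooseP (right_coord_exists a)). Qed.

Lemma left_regularE (a : A) (k : 'I_m) :
  a * e k = \sum_(i < m) e i * j (left_regular a i k).
Proof.
by rewrite {1}[a * e k]right_coordK; apply: eq_bigr => i _; rewrite mxE.
Qed.

Lemma left_regular_uniq (a : A) (M : 'M[B]_m) :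
  (forall k, a * e k = \sum_(i < m) e i * j (M i k)) -> M = left_regular a.
Proof.
move=> defM; apply/matrixP=> i k; rewrite [RHS]mxE.
have [b [_ uniq_b]] := basis_e.2 (a * e k).
rewrite -(uniq_b _ (right_coordK (a * e k))).
suff -> : b = col k M by rewrite mxE.
by apply: uniq_b; rewrite defM; apply: eq_bigr => l _; rewrite mxE.
Qed.

Lemma left_regular_is_zmod_morphism : zmod_morphism left_regular.
Proof.
move=> a b; apply/esym/left_regular_uniq => k.
rewrite mulrBl !left_regularE -sumrB; apply: eq_bigr => i _.
by rewrite !mxE rmorphB mulrBr.
Qed.

Lemma left_regular_is_monoid_morphism : monoid_morphism left_regular.
Proof.
split=> [|a b]; apply/esym/left_regular_uniq => k.
  rewrite mul1r (bigD1 k) //= mxE eqxx rmorph1 mulr1 big1 ?addr0 // => i ik.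
  by rewrite mxE (negPf ik) rmorph0 mulr0.
rewrite -mulrA left_regularE mulr_sumr.
under eq_bigr => i _ do rewrite mulrA left_regularE mulr_suml.
rewrite exchange_big /=; apply: eq_bigr => l _.
rewrite mxE rmorph_sum mulr_sumr; apply: eq_bigr => i _.
by rewrite rmorphM mulrA.
Qed.

End LeftRegular.

(* The basis (f_1 I_r, ..., f_n I_r) of M(r, B) over M(r, C).                *)
Lemma right_basis_scalar_mx (B C : pzRingType) (j : {rmorphism C -> B})
    (n r : nat) (f : 'I_n -> B) :
  right_basis j f ->
  right_basis (map_mx j : {rmorphism 'M[C]_r -> 'M[B]_r})
    (fun i => (f i)%:M).
Proof.
move=> basis_f; split=> [X Y /matrixP eqXY | X].
  by apply/matrixP=> p q; apply: basis_f.1; have:= eqXY p q; rewrite !mxE.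
pose b : 'cV['M[C]_r]_n :=
  \col_i \matrix_(p, q) right_coord basis_f (X p q) i 0.
have sumE (c : 'cV['M[C]_r]_n) p q :
    (\sum_(i < n) (f i)%:M * map_mx j (c i 0)) p q
    = \sum_(i < n) f i * j (c i 0 p q).
  rewrite summxE; apply: eq_bigr => i _.
  by rewrite -mulmxE mul_scalar_mx !mxE.
exists b; split=> [|c defX]; apply/matrixP=> p q.
  rewrite sumE [LHS](right_coordK basis_f).
  by apply: eq_bigr => i _; rewrite !mxE.
rewrite ord1 [LHS]mxE; apply/matrixP=> s t; rewrite [LHS]mxE.
have [d [_ uniq_d]] := basis_f.2 (X s t).
rewrite -(uniq_d _ (right_coordK basis_f _)).
suff -> : d = \col_i c i 0 s t by rewrite mxE.
apply: uniq_d; rewrite defX sumE.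
by apply: eq_bigr => i _; rewrite mxE.
Qed.

Lemma sum_const_ord (n r : nat) : (\sum_(i < n) r = n * r)%N.
Proof. by rewrite sum_nat_const card_ord. Qed.

Definition flatten_mx (T : Type) (n r : nat) (X : 'M['M[T]_r]_n) :
    'M[T]_(n * r) :=
  castmx (sum_const_ord n r, sum_const_ord n r)
    (\mxblock_(i < n, k < n) X i k).

(* Main.v *)
(* After conjugating by the change of basis from g to (f_1 I_r, ..., f_n I_r),
   and swapping the roles of inner and outer indices, L3 X becomes the block
   matrix (L2 (X p q))_(p, q).  So it is enough to show, for a ring morphism phi
   from a commutative ring B to M(n, C), that applying phi to the entries of a
   matrix X over B and taking the nr x nr determinant gives det (phi (det X)).
   This is an induction on r: if a is the top left entry of X, one elimination
   step gives the identity up to a factor det (phi a) ^ r.  To make this factor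
   cancellable, replace X by t I + X over B[t]: it is then a power of a
   characteristic polynomial, hence monic.  Finally specialise t to 0. *)

Require Import Defs.
From HB Require Import structures.
From mathcomp Require Import all_boot all_order all_algebra.
From mathcomp Require Import perm.

Set Implicit Arguments.
Unset Strict Implicit.
Unset Printing Implicit Defensive.

Import GRing.Theory.

Local Open Scope ring_scope.

(** Gives access to polynomial rings. The conclusion is an equality of structures, so that [subst]
    can carry a whole goal over to [R']. *)
Lemma comNz_of_comPz (R : comPzRingType) :
  (1 : R) != 0 -> exists R' : comNzRingType, R = R' :> comPzRingType.
Proof.
case: R => T c /= nz.
pose R := GRing.ComPzRing.Pack c.
pose nzm := GRing.PzSemiRing_isNonZero.Build R nz.
by exists (HB.pack R nzm : comNzRingType).
Qed.

(** * Determinants of flattened block matrices *)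

(** Rows and columns are permuted by the same permutation, so its sign occurs twice and cancels.
    Determinants can thus be computed along any enumeration of pairs of indices. *)
Lemma det_reindex (R : comPzRingType) (T : finType) (F : T -> T -> R) m m'
    (h : 'I_m -> T) (h' : 'I_m' -> T) :
  bijective h -> bijective h' ->
  \det (\matrix_(s, t) F (h s) (h t)) = \det (\matrix_(s, t) F (h' s) (h' t)).
Proof.
move=> bij_h bij_h'; have eq_m : m = m'.
  by rewrite -[m]card_ord -[m']card_ord (bij_eq_card bij_h) (bij_eq_card bij_h').
case: m' / eq_m in h' bij_h' *.
have [h1 hK h1K] := bij_h.
have inj_s : injective (h1 \o h').
  exact: inj_comp (can_inj h1K) (bij_inj bij_h').
pose s := perm inj_s; set A := \matrix_(_, _) _.
have -> : \matrix_(i, k) F (h' i) (h' k) = row_perm s (col_perm s A).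
  by apply/matrixP=> i k; rewrite !mxE !permE /= !h1K.
rewrite row_permE col_permE !det_mulmx !det_perm odd_permV.
by rewrite mulrCA -signr_addb addbb mulr1.
Qed.

Definition flat_coord n r (s : 'I_(n * r)) : 'I_n * 'I_r :=
  let t := cast_ord (esym (sum_const_ord n r)) s in
  (tagnat.sig1 t, tagnat.sig2 t).

Lemma flat_coord_bij n r : bijective (@flat_coord n r).
Proof.
apply: inj_card_bij; last by rewrite card_prod !card_ord.
move=> s t eq_st; apply: (@cast_ord_inj _ _ (esym (sum_const_ord n r))).
apply: tagnat.sig_inj; rewrite !tagnat.sigE12.
by case: eq_st; move: (tagnat.sig2 _) (tagnat.sig2 _) => /= u v -> ->.
Qed.

Lemma flatten_mxE T n r (X : 'M['M[T]_r]_n) s t :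
  flatten_mx X s t
  = X (flat_coord s).1 (flat_coord t).1 (flat_coord s).2 (flat_coord t).2.
Proof. by rewrite castmxE mxE. Qed.

Lemma flatten_mxM (R : pzRingType) n r (X Y : 'M['M[R]_r]_n) :
  flatten_mx (X *m Y) = flatten_mx X *m flatten_mx Y.
Proof.
apply/matrixP=> s t; rewrite flatten_mxE !mxE summxE.
under eq_bigr => k _ do rewrite -mulmxE mxE.
rewrite pair_big /= [LHS](reindex _ (onW_bij _ (flat_coord_bij n r))) /=.
by apply: eq_bigr => u _; rewrite !flatten_mxE.
Qed.

Lemma flatten_mx1 (R : pzRingType) n r :
  flatten_mx (1%:M : 'M['M[R]_r]_n) = 1%:M.
Proof.
apply/matrixP=> s t; rewrite flatten_mxE !mxE.
rewrite -(inj_eq (bij_inj (flat_coord_bij n r))).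
case: (flat_coord s) (flat_coord t) => [i p] [k q]; rewrite xpair_eqE /=.
by case: eqP => _ /=; rewrite !mxE.
Qed.

(** Both flattenings enumerate the same family indexed by pairs, up to exchanging the two
    components. *)
Lemma det_flatten_swap (R : comPzRingType) n r (X : 'M['M[R]_r]_n)
    (Y : 'M['M[R]_n]_r) :
  (forall i k p q, X i k p q = Y p q i k) ->
  \det (flatten_mx X) = \det (flatten_mx Y).
Proof.
move=> eqXY.
pose F (u v : 'I_n * 'I_r) := X u.1 v.1 u.2 v.2.
have -> : flatten_mx X = \matrix_(s, t) F (flat_coord s) (flat_coord t).
  by apply/matrixP=> s t; rewrite flatten_mxE mxE.
pose sw (u : 'I_r * 'I_n) := (u.2, u.1).
have sw_bij : bijective sw by exists (fun u => (u.2, u.1)) => -[].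
rewrite (det_reindex _ (flat_coord_bij n r)
  (bij_comp sw_bij (flat_coord_bij r n))).
by congr (\det _); apply/matrixP=> s t; rewrite flatten_mxE mxE /F /= eqXY.
Qed.

Lemma det_flatten_ublock (R : comPzRingType) n r
    (X : 'M['M[R]_n]_(1 + r)) :
  (forall i, X (rshift 1 i) (lshift r 0) = 0) ->
  \det (flatten_mx X)
  = \det (X (lshift r 0) (lshift r 0)) * \det (flatten_mx (drsubmx X)).
Proof.
move=> X0.
pose F (u v : 'I_(1 + r) * 'I_n) := X u.1 v.1 u.2 v.2.
have -> : flatten_mx X = \matrix_(s, t) F (flat_coord s) (flat_coord t).
  by apply/matrixP=> s t; rewrite flatten_mxE mxE.
(* [h] lists the [n] pairs of the first block row, then all others; along it the flattened matrix is
   literally a [block_mx]. *)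
pose h (s : 'I_(n + r * n)) : 'I_(1 + r) * 'I_n :=
  match split s with
  | inl i => (lshift r 0, i)
  | inr t => (rshift 1 (flat_coord t).1, (flat_coord t).2)
  end.
have hl i : h (lshift _ i) = (lshift r 0, i).
  by rewrite /h (unsplitK (inl i)).
have hr t : h (rshift _ t) = (rshift 1 (flat_coord t).1, (flat_coord t).2).
  by rewrite /h (unsplitK (inr t)).
have h_bij : bijective h.
  apply: inj_card_bij; last by rewrite card_prod !card_ord mulnDl mul1n.
  move=> s t; rewrite -(splitK s) -(splitK t).
  case: (split s) (split t) => [i|u] [k|v] /=; rewrite ?hl ?hr.
  - by case=> ->.
  - by move=> /(congr1 (fun u => val u.1)).
  - by move=> /(congr1 (fun u => val u.1)).
  move=> euv; have /rshift_inj e1 := congr1 fst euv.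
  have e2 : (flat_coord u).2 = (flat_coord v).2 := congr1 snd euv.
  congr (rshift _ _).
  apply: (bij_inj (flat_coord_bij r n)).
  by rewrite [LHS]surjective_pairing e1 e2 -surjective_pairing.
rewrite (det_reindex _ (flat_coord_bij _ _) h_bij).
rewrite -(det_ublock _
  (\matrix_(i, t) X (lshift r 0) (rshift 1 (flat_coord t).1) i (flat_coord t).2)).
congr (\det _); apply/matrixP=> s t; rewrite mxE /F.
rewrite -(splitK s) -(splitK t).
case: (split s) (split t) => [i|u] [k|v] /=; rewrite ?hl ?hr /=.
- by rewrite block_mxEul.
- by rewrite block_mxEur mxE.
- by rewrite block_mxEdl X0 !mxE.
by rewrite block_mxEdr flatten_mxE !mxE.
Qed.

(** Transposing both the outer matrix and each block transposes the flattened matrix, which reduces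
    this to the upper triangular case. *)
Lemma det_flatten_lblock (R : comPzRingType) n r
    (X : 'M['M[R]_n]_(1 + r)) :
  (forall i, X (lshift r 0) (rshift 1 i) = 0) ->
  \det (flatten_mx X)
  = \det (X (lshift r 0) (lshift r 0)) * \det (flatten_mx (drsubmx X)).
Proof.
move=> X0.
have flatT k (Y : 'M['M[R]_n]_k) :
    \det (flatten_mx Y) = \det (flatten_mx (map_mx trmx Y^T)).
  by rewrite -det_tr; congr (\det _); apply/matrixP=> s t;
     rewrite mxE !flatten_mxE !mxE.
rewrite flatT det_flatten_ublock => [|i]; last by rewrite !mxE X0 trmx0.
by rewrite !mxE det_tr -map_drsubmx -trmx_drsub -flatT.
Qed.

(** * Elimination, and specialisation from polynomials *)

Lemma det_flatten_map_regular (B C : comPzRingType) n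
    (phi : {rmorphism B -> 'M[C]_n}) r (X : 'M[B]_(1 + r)) :
  GRing.lreg (\det (phi (X (lshift r 0) (lshift r 0)))) ->
  (forall Y : 'M[B]_r,
    \det (flatten_mx (map_mx phi Y)) = \det (phi (\det Y))) ->
  \det (flatten_mx (map_mx phi X)) = \det (phi (\det X)).
Proof.
set a := X _ _ => reg_a IH.
(* Division-free elimination: the lower rows of [X] are scaled by [a] before multiples of the first
   row are subtracted, which costs the factor [\det Z = a ^+ r]. *)
pose Z : 'M[B]_(1 + r) := block_mx 1%:M 0 (- dlsubmx X) a%:M.
pose W : 'M[B]_r := - dlsubmx X *m ursubmx X + a *: drsubmx X.
have ulX : ulsubmx X = a%:M.
  by apply/matrixP=> i k; rewrite !ord1 !mxE eqxx.
have ZX : Z *m X = block_mx a%:M (ursubmx X) 0 W.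
  rewrite -{1}[X]submxK /Z mulmx_block !mul1mx !mul0mx !addr0 ulX.
  by rewrite mul_mx_scalar !mul_scalar_mx scalerN addNr.
have detZX : a ^+ r * \det X = a * \det W.
  have := congr1 determinant ZX.
  by rewrite det_mulmx det_lblock det_ublock det1 mul1r det_scalar det_scalar1.
have dM u v : \det (phi (u * v)) = \det (phi u) * \det (phi v).
  by rewrite rmorphM -det_mulmx.
have flatZ : \det (flatten_mx (map_mx phi Z)) = \det (phi (a ^+ r)).
  rewrite det_flatten_lblock => [|i]; last by rewrite mxE block_mxEur mxE rmorph0.
  rewrite mxE block_mxEul mxE eqxx mulr1n rmorph1 det1 mul1r.
  by rewrite -map_drsubmx block_mxKdr IH det_scalar.
have flatZX : \det (flatten_mx (map_mx phi (Z *m X)))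
    = \det (phi a) * \det (phi (\det W)).
  rewrite ZX det_flatten_ublock => [|i]; last by rewrite mxE block_mxEdl mxE rmorph0.
  rewrite mxE block_mxEul mxE eqxx mulr1n -map_drsubmx block_mxKdr.
  by rewrite IH.
have reg_aX k : GRing.lreg (\det (phi (a ^+ k))).
  elim: k => [|k IHk]; first by rewrite expr0 rmorph1 det1; apply: lreg1.
  by rewrite exprS dM; apply: lregM.
apply: (reg_aX r); rewrite -{1}flatZ -det_mulmx -flatten_mxM -map_mxM flatZX.
by rewrite -!dM detZX.
Qed.

(** The size [n.+1] makes the matrix ring nontrivial, so that polynomials over it can be
    evaluated. *)
Lemma det_flatten_map n (B C : comNzRingType) (phi : {rmorphism B -> 'M[C]_n.+1})
    r (X : 'M[B]_r) :
  \det (flatten_mx (map_mx phi X)) = \det (phi (\det X)).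
Proof.
(* The rings and [phi] stay general: the induction hypothesis is applied to [phit], over [{poly B}]
   and [{poly C}]. *)
elim: r B C phi X => [|r IHr] B C phi X.
  by rewrite !det_mx00 rmorph1 det1.
pose psi : {rmorphism B -> 'M[{poly C}]_n.+1} := map_mx polyC \o phi.
(* A scalar matrix commutes with the image of [psi], so evaluating at it is a ring morphism: [phit]
   extends [phi] and sends t to t I. *)
have comm_t : commr_rmorph psi ('X%:M : 'M[{poly C}]_n.+1).
  by move=> b; rewrite /GRing.comm -!mulmxE scalar_mxC.
pose phit : {rmorphism {poly B} -> 'M[{poly C}]_n.+1} := horner_morph comm_t.
have phit0 p : map_mx (horner_eval 0) (phit p) = phi p.[0].
  elim/poly_ind: p => [|p c IHp]; first by rewrite horner0 !rmorph0.
  rewrite rmorphD rmorphM /= horner_morphX horner_morphC hornerMXaddC mulr0 add0r.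
  rewrite map_mxD -mulmxE map_mxM.
  have -> : map_mx (horner_eval 0) ('X%:M : 'M[{poly C}]_n.+1) = 0.
    by rewrite map_scalar_mx /= /horner_eval hornerX raddf0.
  rewrite mulmx0 add0r; apply/matrixP=> i k.
  by rewrite mxE /= mxE /horner_eval hornerC.
pose Xt : 'M[{poly B}]_(1 + r) := 'X%:M + map_mx polyC X.
have Xt0 : map_mx (horner_eval 0) Xt = X.
  apply/matrixP=> i k; rewrite !mxE /horner_eval hornerD hornerC hornerMn hornerX.
  by rewrite mul0rn add0r.
have reg_t : GRing.lreg (\det (phit (Xt (lshift r 0) (lshift r 0)))).
  apply: monic_lreg.
  rewrite !mxE eqxx mulr1n rmorphD /= horner_morphX horner_morphC.
  (* The opposite sign comes from [Xt] being t I + X rather than t I - X. *)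
  have -> : 'X%:M + psi (X (@lshift 1 r 0) (@lshift 1 r 0))
      = char_poly_mx (- phi (X (@lshift 1 r 0) (@lshift 1 r 0))).
    by rewrite /char_poly_mx raddfN opprK.
  exact: char_poly_monic.
have := det_flatten_map_regular reg_t (IHr _ _ phit).
move/(congr1 (horner_eval (0 : C))).
rewrite -!(det_map_mx (horner_eval (0 : C))) (phit0 (\det Xt)).
have -> : (\det Xt).[0] = \det X by rewrite -[in RHS]Xt0 det_map_mx.
move=> <-; congr (\det _); apply/matrixP=> s t.
rewrite [RHS]mxE !flatten_mxE [map_mx phit Xt _ _]mxE [map_mx phi X _ _]mxE.
by rewrite -[in LHS]Xt0 [map_mx _ Xt _ _]mxE -phit0 mxE.
Qed.

(** * Change of basis for left regular representations *)

Lemma right_basis_mulmxI (A B : pzRingType) (j : {rmorphism B -> A}) m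
    (e : 'I_m -> A) (basis_e : right_basis j e) p :
  injective (fun M : 'M[B]_(m, p) => (\row_i e i) *m map_mx j M).
Proof.
move=> M N /rowP eqMN; apply/matrixP=> i k.
have [b [_ uniq_b]] := basis_e.2 (((\row_i e i) *m map_mx j M) 0 k).
have colE (U : 'M[B]_(m, p)) : ((\row_i e i) *m map_mx j U) 0 k
    = \sum_(l < m) e l * j (col k U l 0).
  by rewrite mxE; apply: eq_bigr => l _; rewrite !mxE.
have bM : b = col k M by apply: uniq_b; apply: colE.
have bN : b = col k N by apply: uniq_b; rewrite eqMN; apply: colE.
have : col k M = col k N by rewrite -bM.
by move/colP/(_ i); rewrite !mxE.
Qed.

Lemma left_regular_row (A B : pzRingType) (j : {rmorphism B -> A}) m
    (e : 'I_m -> A) (basis_e : right_basis j e) a :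
  a *: (\row_i e i) = (\row_i e i) *m map_mx j (left_regular basis_e a).
Proof.
apply/rowP=> k; rewrite 2!mxE (left_regularE basis_e) mxE.
by apply: eq_bigr => i _; rewrite !mxE.
Qed.

Lemma right_coord_row (A B : pzRingType) (j : {rmorphism B -> A}) m
    (e : 'I_m -> A) (basis_e : right_basis j e) p (e' : 'I_p -> A) :
  exists P : 'M[B]_(m, p), \row_k e' k = (\row_i e i) *m map_mx j P.
Proof.
exists (\matrix_(i, k) right_coord basis_e (e' k) i 0).
apply/rowP=> k; rewrite mxE [LHS](right_coordK basis_e) mxE.
by apply: eq_bigr => i _; rewrite !mxE.
Qed.

(** [P] and [Q] express each basis in the other. Both identities hold after multiplying the row [e]
    by them, and [e] can be cancelled. *)
Lemma left_regular_change_basis (A B : pzRingType) (j : {rmorphism B -> A}) m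
    (e e' : 'I_m -> A) (basis_e : right_basis j e)
    (basis_e' : right_basis j e') :
  exists P Q : 'M[B]_m, P *m Q = 1%:M /\
    forall a, left_regular basis_e a *m P = P *m left_regular basis_e' a.
Proof.
have [P defP] := right_coord_row basis_e e'.
have [Q defQ] := right_coord_row basis_e' e.
exists P, Q; split=> [|a]; apply: (right_basis_mulmxI basis_e) => /=.
  by rewrite map_mxM mulmxA -defP -defQ map_mx1 mulmx1.
rewrite !map_mxM !mulmxA -defP -left_regular_row -left_regular_row defP.
by rewrite scalemxAl.
Qed.

Lemma det_flatten_left_regular (R : comPzRingType) (A : pzRingType) r
    (j : {rmorphism 'M[R]_r -> A}) m (e e' : 'I_m -> A)
    (basis_e : right_basis j e) (basis_e' : right_basis j e') a :
  \det (flatten_mx (left_regular basis_e a))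
  = \det (flatten_mx (left_regular basis_e' a)).
Proof.
have [P [Q [PQ1 /(_ a) eqLP]]] := left_regular_change_basis basis_e basis_e'.
(* [P] has entries in a noncommutative ring in general; flattening turns it into a matrix over [R]
   whose determinant is a unit. *)
have detPQ : \det (flatten_mx P) * \det (flatten_mx Q) = 1.
  by rewrite -det_mulmx -flatten_mxM PQ1 flatten_mx1 det1.
have := congr1 (fun M => \det (flatten_mx M)) eqLP.
rewrite !flatten_mxM !det_mulmx => eq_det.
by rewrite -[LHS]mulr1 -detPQ mulrA eq_det mulrAC detPQ mul1r.
Qed.

(** Multiplication by the scalar matrix of [f k] acts entrywise, so the coordinates of the product
    are found entry by entry, and uniqueness of coordinates concludes. *)
Lemma left_regular_scalar_mx (B : comPzRingType) (C : pzRingType)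
    (j : {rmorphism C -> B}) n r (f : 'I_n -> B) (basis_f : right_basis j f) (X : 'M[B]_r) i k p q :
  left_regular (right_basis_scalar_mx r basis_f) X i k p q
  = left_regular basis_f (X p q) i k.
Proof.
pose L : 'M['M[C]_r]_n :=
  \matrix_(i, k) \matrix_(p, q) left_regular basis_f (X p q) i k.
rewrite -(@left_regular_uniq _ _ _ _ _ _ _ L) ?mxE // => {}k.
apply/matrixP=> {}p {}q.
rewrite -mulmxE /= mul_mx_scalar mxE mulrC (left_regularE basis_f) summxE.
by apply: eq_bigr => l _; rewrite mul_scalar_mx !mxE.
Qed.

(** With the next instance, this lets [L2] serve as [phi] in [det_flatten_map]. *)
HB.instance Definition _ (A B : pzRingType) (j : {rmorphism B -> A}) m
    (e : 'I_m -> A) (basis_e : right_basis j e) :=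
  GRing.isZmodMorphism.Build A 'M[B]_m (left_regular basis_e)
    (left_regular_is_zmod_morphism basis_e).

HB.instance Definition _ (A B : pzRingType) (j : {rmorphism B -> A}) m
    (e : 'I_m -> A) (basis_e : right_basis j e) :=
  GRing.isMonoidMorphism.Build A 'M[B]_m (left_regular basis_e)
    (left_regular_is_monoid_morphism basis_e).

Theorem theorem1p1 (B C : comPzRingType) (j : {rmorphism C -> B}) (n r : nat)
    (f : 'I_n -> B) (basis_f : right_basis j f) (hr : (1 <= r)%N)
    (g : 'I_n -> 'M[B]_r)
    (basis_g : right_basis (map_mx j : {rmorphism 'M[C]_r -> 'M[B]_r}) g) :
  let L2 : B -> 'M[C]_n := left_regular basis_f in
  let L3 : 'M[B]_r -> 'M['M[C]_r]_n := left_regular basis_g in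
  (determinant : 'M[C]_(n * r) -> C) \o @flatten_mx C n r \o L3
    =1 (determinant : 'M[C]_n -> C) \o L2 \o (determinant : 'M[B]_r -> B).
Proof.
move=> L2 L3 X /=; rewrite /L3 => {L3 hr}.
case: n => [|n] in f basis_f g basis_g L2 *; first by rewrite !det_mx00.
rewrite (det_flatten_left_regular _ (right_basis_scalar_mx r basis_f)).
rewrite (det_flatten_swap (Y := map_mx L2 X)) => [|i k p q]; last first.
  by rewrite left_regular_scalar_mx [map_mx _ _ _ _]mxE.
clear g basis_g.
(* Over the zero ring both sides agree; otherwise [B] is nontrivial too, since [j] is injective. *)
have [C0|nzC] := eqVneq (1 : C) 0.
  by rewrite -[LHS]mulr1 -[RHS]mulr1 C0 !mulr0.
have nzB : (1 : B) != 0.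
  by apply: contra_neq nzC => B0; apply: basis_f.1; rewrite rmorph1 rmorph0.
have [C' eqC] := comNz_of_comPz nzC; have [B' eqB] := comNz_of_comPz nzB.
subst C B; exact: det_flatten_map.
Qed.
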